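(* Let $A_0A_1A_2$ be a translation triangle in $\mathbf{Nil}$ with translation triangular surface $\mathcal{S}=\mathcal{S}^{\mathbf{Nil},t}_{A_0A_1A_2}$, and let $T\in\mathcal{S}$ be a point not on any side of the triangle. Let $A_0T, A_1T, A_2T\subset\mathcal{S}$ be the connecting curves in $\mathcal{S}$, and suppose that $A_0T$ and $g^{\mathbf{Nil}}_{A_1A_2}$ meet in $Q$, that $A_1T$ and $g^{\mathbf{Nil}}_{A_0A_2}$ meet in $R$, and that $A_2T$ and $g^{\mathbf{Nil}}_{A_0A_1}$ meet in $P$. Then $$s_g^{\mathbf{Nil}}(A_0,P,A_1)\,s_g^{\mathbf{Nil}}(A_1,Q,A_2)\,s_g^{\mathbf{Nil}}(A_2,R,A_0)=1.$$
   Context: Model. $\mathbf{Nil}$ is $\mathbb{R}^3$ with points $(x,y,z)$, also written $(1,x,y,z)$. The translation by $(x,y,z)$ maps $(a,b,c)\mapsto(x+a,\,y+b,\,z+bx+c)$ and carries the origin to $(x,y,z)$. Fibres are the Euclidean lines parallel to the $z$-axis. Fibrum projection is projection along the fibres. Translation curves. The translation curve starting at the origin with initial tangent vector $(u,v,w)$ is $x(t)=ut$, $y(t)=vt$, $z(t)=\tfrac12uvt^2+wt$, where unit initial velocity means $u^2+v^2+w^2=1$. Translation curves starting at another point $(x_1,y_1,z_1)$ are the images of these under the translation by $(x_1,y_1,z_1)$, i.e. $t\mapsto(x_1+ut,\;y_1+vt,\;z_1+vx_1t+\tfrac12uvt^2+wt)$. Through two distinct points $A,B$ there is a unique translation curve,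 denoted $g^{\mathbf{Nil}}_{AB}$ (taken as a full curve, $t\in\mathbb{R}$). The translation distance $d^{\mathbf{Nil},t}(A,B)$ is the parameter value $t\ge 0$ at which the unit-velocity translation curve starting at $A$ reaches $B$. Simple ratio. For distinct points $A,P,B$ on a translation curve, $s_g^{\mathbf{Nil}}(A,P,B)=d^{\mathbf{Nil},t}(A,P)/d^{\mathbf{Nil},t}(P,B)$ if $P$ is between $A$ and $B$, and $s_g^{\mathbf{Nil}}(A,P,B)=-d^{\mathbf{Nil},t}(A,P)/d^{\mathbf{Nil},t}(P,B)$ otherwise. It is defined only for distinct points, so the relevant points are understood to be distinct. Triangle and surface. A translation triangle $A_0A_1A_2$ is given by three points not lying on one translation curve; its sides are the translation segments joining pairs of vertices. The surface $\mathcal{S}^{\mathbf{Nil},t}_{A_0A_1A_2}$ is the set of all points $P$ such that the tangent vectors at $P$ of the translation curves from $P$ to $A_0$, $A_1$, $A_2$ are coplanar (vertices included). The triangle is of fibre type if this surface is a Euclidean plane, and of general type otherwise. Connecting curves. For points $P_1,P_2\in\mathcal{S}^{\mathbf{Nil},t}_{A_0A_1A_2}$ the connecting curve $P_1P_2\subset\mathcal{S}^{\mathbf{Nil},t}_{A_0A_1A_2}$ is: (1) the translation curve $g^{\mathbf{Nil}}_{P_1P_2}$ if the triangle is of fibre type; (2) the image of $g^{\mathbf{Nil}}_{P_1P_2}$ in the surface under fibrum projection if the triangle is of general type. *)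

(* Defs.v *)
From Stdlib Require Import Reals Lra Psatz ClassicalEpsilon.
From Coquelicot Require Import Coquelicot.
Open Scope R_scope.

(** Points of Nil, and also vectors of its coordinate space. *)
Record pt : Type := Pt { px : R; py : R; pz : R }.

Definition translation (S X : pt) : pt :=
  Pt (px S + px X) (py S + py X) (pz S + py X * px S + pz X).

Definition unit_vec (V : pt) : Prop :=
  px V ^ 2 + py V ^ 2 + pz V ^ 2 = 1.

Definition tcurve0 (V : pt) (t : R) : pt :=
  Pt (px V * t) (py V * t) (/ 2 * px V * py V * t ^ 2 + pz V * t).

(** Its initial direction [V] is the one at the origin, before translating;
    the tangent vector at [A] itself is [is_tangent] below. *)
Definition tcurve (A V : pt) (t : R) : pt := translation A (tcurve0 V t).

Definition on_one_tcurve (A B C : pt) : Prop :=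
  exists (S V : pt) (a b c : R),
    unit_vec V /\ tcurve S V a = A /\ tcurve S V b = B /\ tcurve S V c = C.

Definition translation_triangle (A0 A1 A2 : pt) : Prop :=
  ~ on_one_tcurve A0 A1 A2.

(** The full curve through [A] and [B]; meaningful only for [A <> B]. *)
Definition tline (A B X : pt) : Prop :=
  exists (V : pt) (t s : R),
    unit_vec V /\ tcurve A V t = B /\ tcurve A V s = X.

Definition tsegment (A B X : pt) : Prop :=
  exists (V : pt) (t s : R),
    unit_vec V /\ 0 <= s <= t /\ tcurve A V t = B /\ tcurve A V s = X.

Definition between (A P B : pt) : Prop :=
  tsegment A B P /\ P <> A /\ P <> B.

Definition is_tdist (A B : pt) (t : R) : Prop :=
  0 <= t /\ exists V : pt, unit_vec V /\ tcurve A V t = B.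

Definition tdist (A B : pt) : R := epsilon (inhabits 0) (is_tdist A B).

Definition simple_ratio (A P B : pt) : R :=
  if excluded_middle_informative (between A P B)
  then tdist A P / tdist P B
  else - (tdist A P / tdist P B).

Definition is_tangent (P A W : pt) : Prop :=
  exists (V : pt) (t : R),
    unit_vec V /\ 0 < t /\ tcurve P V t = A /\
    is_derive (fun s => px (tcurve P V s)) 0 (px W) /\
    is_derive (fun s => py (tcurve P V s)) 0 (py W) /\
    is_derive (fun s => pz (tcurve P V s)) 0 (pz W).

Definition dot (X Y : pt) : R := px X * px Y + py X * py Y + pz X * pz Y.

Definition coplanar (W0 W1 W2 : pt) : Prop :=
  exists N : pt, N <> Pt 0 0 0 /\ dot N W0 = 0 /\ dot N W1 = 0 /\ dot N W2 = 0.

(** At a vertex one of the three tangent vectors is undefined, hence the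
    separate clause. *)
Definition tsurface (A0 A1 A2 P : pt) : Prop :=
  (P = A0 \/ P = A1 \/ P = A2) \/
  exists W0 W1 W2 : pt,
    is_tangent P A0 W0 /\ is_tangent P A1 W1 /\ is_tangent P A2 W2 /\
    coplanar W0 W1 W2.

Definition euclidean_plane (E : pt -> Prop) : Prop :=
  exists (N : pt) (d : R), N <> Pt 0 0 0 /\ forall X, E X <-> dot N X = d.

Definition fibre_type (A0 A1 A2 : pt) : Prop :=
  euclidean_plane (tsurface A0 A1 A2).

Definition same_fibre (X Y : pt) : Prop := px X = px Y /\ py X = py Y.

(** [X] lies on the connecting curve [P1 P2] in the surface of the triangle. *)
Definition connecting_curve (A0 A1 A2 P1 P2 X : pt) : Prop :=
  (fibre_type A0 A1 A2 /\ tline P1 P2 X) \/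
  (~ fibre_type A0 A1 A2 /\ tsurface A0 A1 A2 X /\
   exists Y : pt, tline P1 P2 Y /\ same_fibre X Y).

(** The translation distance exists and is unique, so [tdist] is not an
    arbitrary choice. *)
Lemma is_tdist_exists (A B : pt) : exists t, is_tdist A B t.
Proof.
destruct A as [a b c]; destruct B as [x y z].
set (p := x - a); set (q := y - b).
set (r := z - c - a * q - / 2 * p * q).
set (n2 := p ^ 2 + q ^ 2 + r ^ 2).
assert (Hn2 : 0 <= n2) by (unfold n2; nra).
destruct (Req_dec n2 0) as [H0 | H0].
- assert (Hp : p = 0) by (unfold n2 in H0; nra).
  assert (Hq : q = 0) by (unfold n2 in H0; nra).
  assert (Hr : r = 0) by (unfold n2 in H0; nra).
  exists 0; split; [lra | exists (Pt 1 0 0)].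
  unfold unit_vec, tcurve, translation, tcurve0; simpl; split; [ring |].
  unfold r in Hr; rewrite Hq in Hr; unfold p in Hp; unfold q in Hq.
  f_equal; lra.
- assert (Hn : 0 < sqrt n2) by (apply sqrt_lt_R0; lra).
  assert (Hs : sqrt n2 * sqrt n2 = n2) by (apply sqrt_sqrt; lra).
  set (n := sqrt n2) in *.
  exists n; split; [lra | exists (Pt (p / n) (q / n) (r / n))].
  unfold unit_vec, tcurve, translation, tcurve0; simpl; split.
  + replace (_ + _) with (n2 / (n * n)) by (unfold n2; field; lra).
    rewrite Hs; field; exact H0.
  + f_equal; unfold r, p, q; field; lra.
Qed.

Lemma is_tdist_unique (A B : pt) (s t : R) :
  is_tdist A B s -> is_tdist A B t -> s = t.
Proof.
destruct A as [a b c]; destruct B as [x y z].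
intros [Hs [[u v w] [HV HB]]] [Ht [[u' v' w'] [HV' HB']]].
unfold unit_vec, tcurve, translation, tcurve0 in *; simpl in *.
injection HB; injection HB'; intros.
assert (E1 : u * s = u' * t) by lra.
assert (E2 : v * s = v' * t) by lra.
assert (E3 : w * s = w' * t).
{ assert (u * v * s ^ 2 = u' * v' * t ^ 2).
  { replace (u * v * s ^ 2) with ((u * s) * (v * s)) by ring.
    rewrite E1, E2; ring. }
  assert (v * s * a = v' * t * a) by (rewrite E2; ring).
  nra. }
assert (E : s ^ 2 = t ^ 2).
{ replace (s ^ 2) with ((u * s) ^ 2 + (v * s) ^ 2 + (w * s) ^ 2)
    by (transitivity ((u ^ 2 + v ^ 2 + w ^ 2) * s ^ 2); [ring | simpl; rewrite HV; ring]).
  rewrite E1, E2, E3.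
  transitivity ((u' ^ 2 + v' ^ 2 + w' ^ 2) * t ^ 2); [ring | simpl; rewrite HV'; ring]. }
nra.
Qed.

Lemma tdist_spec (A B : pt) : is_tdist A B (tdist A B).
Proof. exact (epsilon_spec _ _ (is_tdist_exists A B)). Qed.

(* Main.v *)
Require Import Defs.
From Stdlib Require Import Reals Lra ClassicalEpsilon.
From Coquelicot Require Import Coquelicot.
Open Scope R_scope.

(** The theorem is Ceva's theorem of the affine plane, seen through the
    exponential coordinates [(x, y, z - x y / 2)] of the Heisenberg group.

    In these coordinates ([straighten]) every translation curve is a Euclidean
    line run through at constant speed ([straighten_tcurve]).  This has three
    consequences.  The simple ratio of three points of a translation curve is
    their signed affine ratio [s / (1 - s)] ([simple_ratio_affine]), because
    both distances are measured along one curve with one unit direction.  The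
    curves from [P] to the vertices have coplanar tangents exactly when the
    straightened vertices and [P] are coplanar, since the differential of
    [straighten] is invertible; so the surface of the triangle becomes the plane
    spanned by its vertices ([tsurface_iff_plane]).  Finally, every connecting
    curve is the translation curve itself ([connecting_curve_affine]): that curve
    already lies in the surface, and for a triangle of general type the plane is
    not vertical, so a fibre meets the surface only once and the fibrum
    projection moves nothing.

    What remains is the classical computation ([ceva]): if [T] has barycentric
    coordinates [t0, t1, t2], the three ratios are [t1 / t0], [t2 / t1] and
    [t0 / t2], whose product is [1].  [T] may lie on the extension of a side: then
    one of the points of division would be a vertex, which is excluded. *)

(** * Straightening the translation curves *)

Definition straighten (X : pt) : pt := Pt (px X) (py X) (pz X - / 2 * px X * py X).

Definition affine (X Y : pt) (s : R) : pt :=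
  Pt ((1 - s) * px X + s * px Y)
     ((1 - s) * py X + s * py Y)
     ((1 - s) * pz X + s * pz Y).

Definition affine_param (A B : pt) (s : R) (X : pt) : Prop :=
  straighten X = affine (straighten A) (straighten B) s.

Definition vsub (X Y : pt) : pt := Pt (px X - px Y) (py X - py Y) (pz X - pz Y).

Definition scal (s : R) (X : pt) : pt := Pt (s * px X) (s * py X) (s * pz X).

Definition cross (X Y : pt) : pt :=
  Pt (py X * pz Y - pz X * py Y)
     (pz X * px Y - px X * pz Y)
     (px X * py Y - py X * px Y).

Lemma straighten_inj (X Y : pt) : straighten X = straighten Y -> X = Y.
Proof.
destruct X as [a b c], Y as [x y z]; unfold straighten; simpl.
intros H; injection H; intros H3 H2 H1; subst; f_equal; lra.
Qed.

(** The quadratic term of the curve is cancelled by that of [x y / 2]. *)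
Lemma straighten_tcurve (A V : pt) (t : R) :
  vsub (straighten (tcurve A V t)) (straighten A) =
  scal t (Pt (px V) (py V) (pz V + / 2 * (px A * py V - py A * px V))).
Proof.
destruct A as [a b c], V as [u v w].
unfold vsub, straighten, tcurve, tcurve0, translation, scal; simpl.
f_equal; field.
Qed.

Lemma tcurve_0 (A V : pt) : tcurve A V 0 = A.
Proof.
destruct A, V; unfold tcurve, tcurve0, translation; simpl; f_equal; ring.
Qed.

(** A translation curve is a left coset of a one-parameter subgroup. *)
Lemma tcurve_add (A V : pt) (s t : R) :
  tcurve (tcurve A V s) V t = tcurve A V (s + t).
Proof.
destruct A, V; unfold tcurve, tcurve0, translation; simpl; f_equal; field.
Qed.

Lemma tcurve_opp (A V : pt) (t : R) :
  tcurve A (scal (-1) V) (- t) = tcurve A V t.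
Proof.
destruct A, V; unfold tcurve, tcurve0, translation, scal; simpl; f_equal; field.
Qed.

Lemma unit_vec_opp (V : pt) : unit_vec V -> unit_vec (scal (-1) V).
Proof. unfold unit_vec, scal; simpl; intros H; lra. Qed.

Lemma affine_param_tcurve (A V : pt) (t s : R) :
  affine_param A (tcurve A V t) s (tcurve A V (s * t)).
Proof.
destruct A, V.
unfold affine_param, affine, straighten, tcurve, tcurve0, translation; simpl.
f_equal; field.
Qed.

Lemma affine_param_unique (A B X Y : pt) (s : R) :
  affine_param A B s X -> affine_param A B s Y -> X = Y.
Proof.
unfold affine_param; intros H H'; rewrite <- H' in H; now apply straighten_inj.
Qed.

Lemma affine_param_sym (A B X : pt) (s : R) :
  affine_param A B s X -> affine_param B A (1 - s) X.
Proof. unfold affine_param; intros ->; unfold affine; f_equal; ring. Qed.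

Lemma affine_param_neq_l (A B X : pt) (s : R) :
  affine_param A B s X -> X <> A -> s <> 0.
Proof.
intros H HX ->; apply HX, (affine_param_unique A B _ _ 0); [exact H |].
unfold affine_param, affine; destruct (straighten A); simpl; f_equal; ring.
Qed.

Lemma affine_param_neq_r (A B X : pt) (s : R) :
  affine_param A B s X -> X <> B -> 1 - s <> 0.
Proof.
intros H; apply affine_param_neq_l with (B := A), affine_param_sym, H.
Qed.

Lemma affine_param_inj (A B X : pt) (s t : R) :
  A <> B -> affine_param A B s X -> affine_param A B t X -> s = t.
Proof.
unfold affine_param; intros HAB -> H.
destruct (Req_dec s t) as [| Hst]; [assumption | exfalso; apply HAB].
apply straighten_inj.
destruct (straighten A) as [a b c], (straighten B) as [x y z].
unfold affine in H; simpl in H; injection H; intros H3 H2 H1.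
f_equal; apply Rmult_eq_reg_l with (s - t); lra.
Qed.

Lemma tcurve_affine_param (A B V : pt) (t s : R) :
  A <> B -> tcurve A V t = B -> affine_param A B (s / t) (tcurve A V s).
Proof.
intros HAB HB.
assert (Ht : t <> 0) by (intros ->; apply HAB; now rewrite <- HB, tcurve_0).
generalize (affine_param_tcurve A V t (s / t)); rewrite HB.
now replace (s / t * t) with s by (field; exact Ht).
Qed.

Lemma tline_affine_param (A B X : pt) :
  A <> B -> tline A B X -> exists s, affine_param A B s X.
Proof.
intros HAB (V & t & s & _ & HB & <-).
exists (s / t); now apply tcurve_affine_param.
Qed.

(** * The simple ratio is the affine ratio *)

Lemma unit_tcurve_exists (A B : pt) :
  exists V t, 0 <= t /\ unit_vec V /\ tcurve A V t = B.
Proof.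
destruct (tdist_spec A B) as [Ht [V [HV HB]]]; now exists V, (tdist A B).
Qed.

Lemma tdist_tcurve (A V : pt) (t : R) :
  unit_vec V -> tdist A (tcurve A V t) = Rabs t.
Proof.
intros HV; apply (is_tdist_unique _ _ _ _ (tdist_spec _ _)).
split; [apply Rabs_pos |].
destruct (Rle_dec 0 t) as [Ht | Ht].
- exists V; rewrite Rabs_pos_eq by exact Ht; now split.
- exists (scal (-1) V); rewrite Rabs_left by lra.
  split; [now apply unit_vec_opp | apply tcurve_opp].
Qed.

Lemma tsegment_left (A B : pt) : tsegment A B A.
Proof.
destruct (unit_tcurve_exists A B) as (V & t & Ht & HV & HB).
exists V, t, 0; repeat split; auto using tcurve_0; lra.
Qed.

Lemma tsegment_affine_param (A B X : pt) (s : R) :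
  A <> B -> affine_param A B s X -> (tsegment A B X <-> 0 <= s <= 1).
Proof.
intros HAB HX; split.
- intros (V & t & r & _ & Hr & HB & HrX).
  assert (Ht : t <> 0) by (intros ->; apply HAB; now rewrite <- HB, tcurve_0).
  assert (Hs : s = r / t).
  { apply (affine_param_inj A B X); auto.
    rewrite <- HrX; now apply tcurve_affine_param. }
  assert (Hrt : r = s * t) by (rewrite Hs; field; exact Ht).
  split; apply Rmult_le_reg_r with t; lra.
- intros Hs; destruct (unit_tcurve_exists A B) as (V & t & Ht & HV & HB).
  exists V, t, (s * t); repeat split; try nra; auto.
  apply (affine_param_unique A B _ _ s); auto.
  rewrite <- HB; apply affine_param_tcurve.
Qed.

(** Along one unit-speed curve from [A] to [B], of length [t], the two distances
    are [|s| t] and [|1 - s| t]; the sign convention of the simple ratio undoes the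
    absolute values, as [s] and [1 - s] have the same sign exactly when [P] lies
    between [A] and [B]. *)
Lemma simple_ratio_affine (A P B : pt) (s : R) :
  A <> B -> P <> A -> P <> B -> affine_param A B s P ->
  simple_ratio A P B = s / (1 - s).
Proof.
intros HAB HPA HPB HP.
assert (Hs0 : s <> 0) by exact (affine_param_neq_l _ _ _ _ HP HPA).
assert (Hs1 : 1 - s <> 0) by exact (affine_param_neq_r _ _ _ _ HP HPB).
destruct (unit_tcurve_exists A B) as (V & t & Ht & HV & HB).
assert (Ht0 : t <> 0) by (intros ->; apply HAB; now rewrite <- HB, tcurve_0).
assert (EP : P = tcurve A V (s * t)).
{ apply (affine_param_unique A B _ _ s); auto.
  rewrite <- HB; apply affine_param_tcurve. }
assert (EB : B = tcurve P V ((1 - s) * t)).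
{ rewrite EP, tcurve_add, <- HB; f_equal; ring. }
assert (DA : tdist A P = Rabs s * t).
{ rewrite EP, (tdist_tcurve _ _ _ HV), Rabs_mult.
  now rewrite (Rabs_pos_eq t). }
assert (DB : tdist P B = Rabs (1 - s) * t).
{ rewrite EB, (tdist_tcurve _ _ _ HV), Rabs_mult.
  now rewrite (Rabs_pos_eq t). }
unfold simple_ratio; rewrite DA, DB.
destruct (excluded_middle_informative (between A P B)) as [Hb | Hb].
- destruct Hb as [Hb _]; apply (tsegment_affine_param A B P s HAB HP) in Hb.
  rewrite !Rabs_pos_eq by lra; field; auto.
- assert (Hn : ~ 0 <= s <= 1).
  { intros Hs; apply Hb; split; auto.
    now apply (tsegment_affine_param A B P s HAB HP). }
  destruct (Rle_dec 0 s).
  + rewrite (Rabs_pos_eq s), (Rabs_left (1 - s)) by lra; field; split; lra.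
  + rewrite (Rabs_left s), (Rabs_pos_eq (1 - s)) by lra; field; split; lra.
Qed.

(** * The surface is a plane *)

Definition normal (A0 A1 A2 : pt) : pt :=
  cross (vsub (straighten A1) (straighten A0)) (vsub (straighten A2) (straighten A0)).

Definition in_plane (A0 A1 A2 X : pt) : Prop :=
  dot (normal A0 A1 A2) (vsub (straighten X) (straighten A0)) = 0.

(** The differential of [straighten] at [P]. *)
Definition dstraighten (P W : pt) : pt :=
  Pt (px W) (py W) (pz W - / 2 * (px P * py W + py P * px W)).

(** Two vectors with zero cross product are proportional, and a common multiple
    of one direction means a common translation curve. *)
Lemma normal_neq_0 (A0 A1 A2 : pt) :
  translation_triangle A0 A1 A2 -> normal A0 A1 A2 <> Pt 0 0 0.
Proof.
intros HA HN; apply HA.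
destruct (excluded_middle_informative (A0 = A1)) as [<- | H01].
- destruct (unit_tcurve_exists A0 A2) as (V & t & _ & HV & H2).
  exists A0, V, 0, 0, t; repeat split; auto using tcurve_0.
- assert (HC : exists s, affine_param A0 A1 s A2).
  { assert (HS : straighten A0 <> straighten A1)
      by (intros E; apply H01, straighten_inj, E).
    unfold affine_param, normal in *.
    destruct (straighten A0) as [a b c], (straighten A1) as [d e f],
      (straighten A2) as [x y z].
    unfold cross, vsub, affine in *; simpl in *; injection HN; intros N3 N2 N1.
    destruct (Req_dec (d - a) 0) as [Hd | Hd].
    1: destruct (Req_dec (e - b) 0) as [He | He].
    1: destruct (Req_dec (f - c) 0) as [Hf | Hf].
    - exfalso; apply HS; f_equal; lra.
    - exists ((z - c) / (f - c)); f_equal; apply Rmult_eq_reg_l with (f - c); auto;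
        field_simplify; auto; lra.
    - exists ((y - b) / (e - b)); f_equal; apply Rmult_eq_reg_l with (e - b); auto;
        field_simplify; auto; lra.
    - exists ((x - a) / (d - a)); f_equal; apply Rmult_eq_reg_l with (d - a); auto;
        field_simplify; auto; lra. }
  destruct HC as [s Hs].
  destruct (unit_tcurve_exists A0 A1) as (V & t & _ & HV & H1).
  exists A0, V, 0, t, (s * t); repeat split; auto using tcurve_0.
  apply (affine_param_unique A0 A1 _ _ s); auto.
  rewrite <- H1; apply affine_param_tcurve.
Qed.

Lemma is_derive_tcurve (P V : pt) :
  is_derive (fun s => px (tcurve P V s)) 0 (px V) /\
  is_derive (fun s => py (tcurve P V s)) 0 (py V) /\
  is_derive (fun s => pz (tcurve P V s)) 0 (pz V + py V * px P).
Proof.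
destruct P, V; unfold tcurve, tcurve0, translation; simpl.
split; [| split]; auto_derive; auto; field.
Qed.

Lemma is_tangent_iff (P A W : pt) :
  is_tangent P A W <->
  exists V t, unit_vec V /\ 0 < t /\ tcurve P V t = A /\
    W = Pt (px V) (py V) (pz V + py V * px P).
Proof.
split; intros (V & t & HV & Ht & HA & HW); exists V, t;
  destruct (is_derive_tcurve P V) as (D1 & D2 & D3).
- destruct HW as (E1 & E2 & E3), W as [W1 W2 W3]; simpl in *.
  apply is_derive_unique in D1, D2, D3, E1, E2, E3.
  do 3 (split; auto); f_equal; congruence.
- subst W; auto 10.
Qed.

(** A straightened curve is a line, so the straightened tangent vector at [P] is
    parallel to the chord from [P] to [A]. *)
Lemma is_tangent_straighten (P A W : pt) :
  is_tangent P A W ->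
  exists t, 0 < t /\ vsub (straighten A) (straighten P) = scal t (dstraighten P W).
Proof.
intros (V & t & _ & Ht & <- & ->)%is_tangent_iff; exists t; split; auto.
rewrite straighten_tcurve; unfold dstraighten; simpl; do 2 f_equal; field.
Qed.

Lemma is_tangent_exists (P A : pt) : P <> A -> exists W, is_tangent P A W.
Proof.
intros HPA; destruct (unit_tcurve_exists P A) as (V & t & Ht & HV & HA).
exists (Pt (px V) (py V) (pz V + py V * px P)); apply is_tangent_iff.
exists V, t; repeat split; auto.
destruct Ht as [Ht | <-]; auto.
exfalso; apply HPA; rewrite <- HA; now rewrite tcurve_0.
Qed.

(** Transposed differential of [straighten] at [P], acting on normal vectors. *)
Definition dstraighten_tr (P N : pt) : pt :=
  Pt (px N - / 2 * pz N * py P) (py N - / 2 * pz N * px P) (pz N).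

Lemma dot_dstraighten (P N W : pt) :
  dot N (dstraighten P W) = dot (dstraighten_tr P N) W.
Proof. unfold dot, dstraighten, dstraighten_tr; simpl; field. Qed.

Lemma dot_scal_r (N W : pt) (t : R) : dot N (scal t W) = t * dot N W.
Proof. unfold dot, scal; simpl; ring. Qed.

Lemma dstraighten_tr_onto (P M : pt) :
  M <> Pt 0 0 0 -> exists N, N <> Pt 0 0 0 /\ dstraighten_tr P N = M.
Proof.
destruct M as [m1 m2 m3]; intros HM.
exists (Pt (m1 + / 2 * m3 * py P) (m2 + / 2 * m3 * px P) m3); split.
- intros H; injection H; intros H3 H2 H1; apply HM.
  rewrite H3 in H1, H2 |- *; f_equal; lra.
- unfold dstraighten_tr; simpl; f_equal; ring.
Qed.

Lemma dstraighten_tr_neq_0 (P N : pt) :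
  N <> Pt 0 0 0 -> dstraighten_tr P N <> Pt 0 0 0.
Proof.
destruct N as [n1 n2 n3]; intros HN H.
unfold dstraighten_tr in H; simpl in H; injection H; intros H3 H2 H1; apply HN.
rewrite H3 in H1, H2 |- *; f_equal; lra.
Qed.

(** By Cramer's rule, each coordinate of the common normal vector, times the
    determinant, is a combination of the three vanishing scalar products. *)
Lemma coplanar_det (D0 D1 D2 : pt) : coplanar D0 D1 D2 -> dot D0 (cross D1 D2) = 0.
Proof.
intros (N & HN & H0 & H1 & H2).
destruct (Req_dec (dot D0 (cross D1 D2)) 0) as [| Hd]; auto; exfalso; apply HN.
destruct N as [n1 n2 n3].
assert (E1 : dot D0 (cross D1 D2) * n1 =
  dot (Pt n1 n2 n3) D0 * px (cross D1 D2) + dot (Pt n1 n2 n3) D1 * px (cross D2 D0)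
  + dot (Pt n1 n2 n3) D2 * px (cross D0 D1)) by (unfold dot, cross; simpl; ring).
assert (E2 : dot D0 (cross D1 D2) * n2 =
  dot (Pt n1 n2 n3) D0 * py (cross D1 D2) + dot (Pt n1 n2 n3) D1 * py (cross D2 D0)
  + dot (Pt n1 n2 n3) D2 * py (cross D0 D1)) by (unfold dot, cross; simpl; ring).
assert (E3 : dot D0 (cross D1 D2) * n3 =
  dot (Pt n1 n2 n3) D0 * pz (cross D1 D2) + dot (Pt n1 n2 n3) D1 * pz (cross D2 D0)
  + dot (Pt n1 n2 n3) D2 * pz (cross D0 D1)) by (unfold dot, cross; simpl; ring).
rewrite H0, H1, H2 in E1, E2, E3.
f_equal; apply Rmult_eq_reg_l with (dot D0 (cross D1 D2)); auto; lra.
Qed.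

Lemma in_plane_det (A0 A1 A2 X : pt) :
  in_plane A0 A1 A2 X <->
  dot (vsub (straighten A0) (straighten X))
    (cross (vsub (straighten A1) (straighten X))
           (vsub (straighten A2) (straighten X))) = 0.
Proof.
unfold in_plane, normal, dot, cross, vsub; simpl; split; intros H; nra.
Qed.

Lemma vertices_in_plane (A0 A1 A2 : pt) :
  in_plane A0 A1 A2 A0 /\ in_plane A0 A1 A2 A1 /\ in_plane A0 A1 A2 A2.
Proof.
unfold in_plane, normal, dot, cross, vsub; simpl; repeat split; ring.
Qed.

Lemma normal_orthogonal (A0 A1 A2 A X : pt) :
  in_plane A0 A1 A2 A -> in_plane A0 A1 A2 X ->
  dot (normal A0 A1 A2) (vsub (straighten A) (straighten X)) = 0.
Proof.
unfold in_plane; generalize (normal A0 A1 A2); intros N HA HX.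
unfold dot, vsub in *; simpl in *; lra.
Qed.

(** Coplanarity of the tangent vectors is carried to coplanarity of the chords by
    the differential of [straighten], on normal vectors by its transpose; both
    are invertible, so no point is gained or lost. *)
Lemma tsurface_iff_plane (A0 A1 A2 X : pt) :
  translation_triangle A0 A1 A2 -> (tsurface A0 A1 A2 X <-> in_plane A0 A1 A2 X).
Proof.
intros HA; destruct (vertices_in_plane A0 A1 A2) as (V0 & V1 & V2); split.
- intros [[-> | [-> | ->]] | (W0 & W1 & W2 & T0 & T1 & T2 & M & HM & O0 & O1 & O2)];
    auto.
  apply in_plane_det, coplanar_det.
  destruct (dstraighten_tr_onto X M HM) as (N & HN & <-).
  exists N; split; auto.
  destruct (is_tangent_straighten _ _ _ T0) as (t0 & _ & ->).
  destruct (is_tangent_straighten _ _ _ T1) as (t1 & _ & ->).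
  destruct (is_tangent_straighten _ _ _ T2) as (t2 & _ & ->).
  rewrite !dot_scal_r, !dot_dstraighten, O0, O1, O2; repeat split; ring.
- intros HX.
  destruct (excluded_middle_informative (X = A0)) as [E0 | E0]; [left; auto |].
  destruct (excluded_middle_informative (X = A1)) as [E1 | E1]; [left; auto |].
  destruct (excluded_middle_informative (X = A2)) as [E2 | E2]; [left; auto |].
  right.
  destruct (is_tangent_exists X A0 E0) as [W0 T0].
  destruct (is_tangent_exists X A1 E1) as [W1 T1].
  destruct (is_tangent_exists X A2 E2) as [W2 T2].
  exists W0, W1, W2; repeat split; auto.
  exists (dstraighten_tr X (normal A0 A1 A2)).
  split; [now apply dstraighten_tr_neq_0, normal_neq_0 |].
  assert (HO : forall A W, in_plane A0 A1 A2 A -> is_tangent X A W ->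
    dot (dstraighten_tr X (normal A0 A1 A2)) W = 0).
  { intros A W HAp HW.
    destruct (is_tangent_straighten _ _ _ HW) as (t & Ht & E).
    generalize (normal_orthogonal A0 A1 A2 A X HAp HX).
    rewrite E, dot_scal_r, dot_dstraighten.
    intros [H | H]%Rmult_integral; [lra | exact H]. }
  repeat split; eauto.
Qed.

(** * Connecting curves are translation curves *)

(** If the straightened plane is vertical, the quadratic term [x y / 2] drops out
    of its equation, which is then also the equation of a plane in the original
    coordinates. *)
Lemma vertical_fibre_type (A0 A1 A2 : pt) :
  translation_triangle A0 A1 A2 -> pz (normal A0 A1 A2) = 0 -> fibre_type A0 A1 A2.
Proof.
intros HA Hz.
exists (normal A0 A1 A2), (dot (normal A0 A1 A2) A0).
split; [now apply normal_neq_0 |]; intros X.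
rewrite (tsurface_iff_plane _ _ _ _ HA); unfold in_plane.
destruct (normal A0 A1 A2) as [n1 n2 n3]; simpl in Hz; subst n3.
unfold dot, vsub, straighten; simpl; lra.
Qed.

Lemma affine_in_plane (A0 A1 A2 B C X : pt) (s : R) :
  in_plane A0 A1 A2 B -> in_plane A0 A1 A2 C -> affine_param B C s X ->
  in_plane A0 A1 A2 X.
Proof.
unfold in_plane, affine_param; generalize (normal A0 A1 A2); intros N HB HC ->.
transitivity ((1 - s) * dot N (vsub (straighten B) (straighten A0))
  + s * dot N (vsub (straighten C) (straighten A0))).
- unfold dot, vsub, affine; simpl; ring.
- rewrite HB, HC; ring.
Qed.

Lemma plane_fibre_unique (A0 A1 A2 X Y : pt) :
  pz (normal A0 A1 A2) <> 0 -> in_plane A0 A1 A2 X -> in_plane A0 A1 A2 Y ->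
  same_fibre X Y -> X = Y.
Proof.
unfold in_plane; destruct X as [x y z], Y as [x' y' z'].
destruct (normal A0 A1 A2) as [n1 n2 n3]; intros Hz HX HY [E1 E2].
unfold dot, vsub, straighten in *; simpl in *; subst x' y'.
f_equal; apply Rmult_eq_reg_l with n3; auto; lra.
Qed.

(** For a triangle of general type, the translation curve through two points of
    the surface stays in the surface, so the point of the curve on a given fibre
    is also the point of the surface on it. *)
Lemma connecting_curve_affine (A0 A1 A2 B C X : pt) :
  translation_triangle A0 A1 A2 ->
  in_plane A0 A1 A2 B -> in_plane A0 A1 A2 C -> B <> C ->
  connecting_curve A0 A1 A2 B C X -> exists s, affine_param B C s X.
Proof.
intros HA HB HC HBC [[_ HX] | (HF & HX & Y & HY & HXY)].
- now apply tline_affine_param.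
- destruct (tline_affine_param _ _ _ HBC HY) as [s Hs].
  assert (E : X = Y).
  { apply (plane_fibre_unique A0 A1 A2); auto.
    - intros Hz; apply HF; now apply vertical_fibre_type.
    - now apply tsurface_iff_plane.
    - now apply (affine_in_plane A0 A1 A2 B C Y s). }
  exists s; now rewrite E.
Qed.

(** * Ceva's theorem in the plane *)

(** Multiplying the relation by either vector kills one of the two terms. *)
Lemma cross_independent (D E : pt) (a b : R) :
  cross D E <> Pt 0 0 0 ->
  a * px D + b * px E = 0 -> a * py D + b * py E = 0 -> a * pz D + b * pz E = 0 ->
  a = 0 /\ b = 0.
Proof.
intros HN H1 H2 H3.
destruct D as [d1 d2 d3], E as [e1 e2 e3]; unfold cross in HN; simpl in *.
split.
- destruct (Req_dec a 0) as [| Ha]; auto; exfalso; apply HN.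
  f_equal; apply Rmult_eq_reg_l with a; auto; rewrite Rmult_0_r.
  + transitivity ((a * d2 + b * e2) * e3 - (a * d3 + b * e3) * e2);
      [ring | rewrite H2, H3; ring].
  + transitivity ((a * d3 + b * e3) * e1 - (a * d1 + b * e1) * e3);
      [ring | rewrite H1, H3; ring].
  + transitivity ((a * d1 + b * e1) * e2 - (a * d2 + b * e2) * e1);
      [ring | rewrite H1, H2; ring].
- destruct (Req_dec b 0) as [| Hb]; auto; exfalso; apply HN.
  f_equal; apply Rmult_eq_reg_l with b; auto; rewrite Rmult_0_r.
  + transitivity ((a * d3 + b * e3) * d2 - (a * d2 + b * e2) * d3);
      [ring | rewrite H2, H3; ring].
  + transitivity ((a * d1 + b * e1) * d3 - (a * d3 + b * e3) * d1);
      [ring | rewrite H1, H3; ring].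
  + transitivity ((a * d2 + b * e2) * d1 - (a * d1 + b * e1) * d2);
      [ring | rewrite H1, H2; ring].
Qed.

(** With barycentric coordinates [1 - y1 - y2, y1, y2] of [T], the numbers
    [l, m, n] are proportional to [y1, y2, 1 - y1 - y2] and their complements to
    [1 - y1 - y2, y1, y2], with the factors [t, s, r] in both cases.  As a product
    identity without quotients it allows the points of division to be vertices. *)
Lemma ceva (A0 A1 A2 T : pt) (l m n r s t : R) :
  cross (vsub A1 A0) (vsub A2 A0) <> Pt 0 0 0 ->
  affine A0 A1 l = affine A2 T t ->
  affine A1 A2 m = affine A0 T s ->
  affine A2 A0 n = affine A1 T r ->
  l * m * n = (1 - l) * (1 - m) * (1 - n).
Proof.
intros HN HP HQ HR.
destruct A0 as [a b c], A1 as [d e f], A2 as [g h i], T as [x y z].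
unfold affine in *; simpl in *.
injection HP; injection HQ; injection HR; clear HP HQ HR.
intros R3 R2 R1 Q3 Q2 Q1 P3 P2 P1.
assert (Hs : s <> 0).
{ intros ->; destruct (cross_independent _ _ (1 - m) m HN); simpl; lra. }
(* [y1] and [y2] are the barycentric coordinates of [T] at [A1] and [A2]: seen from
   [A0], the point on the line [A1 A2] is [s] times [T], and its own coordinates
   are [1 - m] and [m]. *)
set (y1 := (1 - m) / s); set (y2 := m / s).
assert (X1 : x = a + y1 * (d - a) + y2 * (g - a)).
{ apply Rmult_eq_reg_l with s; auto; unfold y1, y2; field_simplify; auto; lra. }
assert (X2 : y = b + y1 * (e - b) + y2 * (h - b)).
{ apply Rmult_eq_reg_l with s; auto; unfold y1, y2; field_simplify; auto; lra. }
assert (X3 : z = c + y1 * (f - c) + y2 * (i - c)).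
{ apply Rmult_eq_reg_l with s; auto; unfold y1, y2; field_simplify; auto; lra. }
assert (M1 : 1 - m = s * y1) by (unfold y1; field; auto).
assert (M2 : m = s * y2) by (unfold y2; field; auto).
clearbody y1 y2; subst x y z.
destruct (cross_independent _ _ (1 - r + r * y1) (r * y2 - (1 - n)) HN) as [N1 N2];
  simpl; try lra.
destruct (cross_independent _ _ (t * y1 - l) (1 - t + t * y2) HN) as [L1 L2];
  simpl; try lra.
assert (EL : 1 - l = t * (1 - y1 - y2)) by lra.
assert (EN : n = r * (1 - y1 - y2)) by lra.
assert (EL' : l = t * y1) by lra.
assert (EN' : 1 - n = r * y2) by lra.
rewrite EL, M1, EN', EL', M2, EN; ring.
Qed.

Theorem theorem3p16 (A0 A1 A2 T P Q R' : pt)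
  (hA : translation_triangle A0 A1 A2)
  (hT : tsurface A0 A1 A2 T)
  (hT01 : ~ tsegment A0 A1 T)
  (hT12 : ~ tsegment A1 A2 T)
  (hT20 : ~ tsegment A2 A0 T)
  (hQ0 : connecting_curve A0 A1 A2 A0 T Q) (hQ : tline A1 A2 Q)
  (hR1 : connecting_curve A0 A1 A2 A1 T R') (hR : tline A0 A2 R')
  (hP2 : connecting_curve A0 A1 A2 A2 T P) (hP : tline A0 A1 P)
  (hPA0 : P <> A0) (hPA1 : P <> A1)
  (hQA1 : Q <> A1) (hQA2 : Q <> A2)
  (hRA2 : R' <> A2) (hRA0 : R' <> A0) :
  simple_ratio A0 P A1 * simple_ratio A1 Q A2 * simple_ratio A2 R' A0 = 1.
Proof.
assert (HN := normal_neq_0 _ _ _ hA).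
assert (H01 : A0 <> A1).
{ intros <-; apply HN; unfold normal, cross, vsub; simpl; f_equal; ring. }
assert (H02 : A0 <> A2).
{ intros <-; apply HN; unfold normal, cross, vsub; simpl; f_equal; ring. }
assert (H12 : A1 <> A2).
{ intros <-; apply HN; unfold normal, cross, vsub; simpl; f_equal; ring. }
assert (T0 : A0 <> T) by (intros <-; apply hT01, tsegment_left).
assert (T1 : A1 <> T) by (intros <-; apply hT12, tsegment_left).
assert (T2 : A2 <> T) by (intros <-; apply hT20, tsegment_left).
destruct (vertices_in_plane A0 A1 A2) as (V0 & V1 & V2).
assert (VT : in_plane A0 A1 A2 T) by now apply tsurface_iff_plane.
destruct (connecting_curve_affine _ _ _ _ _ _ hA V0 VT T0 hQ0) as [s Hs].
destruct (connecting_curve_affine _ _ _ _ _ _ hA V1 VT T1 hR1) as [r Hr].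
destruct (connecting_curve_affine _ _ _ _ _ _ hA V2 VT T2 hP2) as [t Ht].
destruct (tline_affine_param _ _ _ H01 hP) as [l Hl].
destruct (tline_affine_param _ _ _ H12 hQ) as [m Hm].
destruct (tline_affine_param _ _ _ H02 hR) as [n' Hn'].
assert (Hn := affine_param_sym _ _ _ _ Hn'); set (n := 1 - n') in Hn.
rewrite (simple_ratio_affine _ _ _ l H01 hPA0 hPA1 Hl).
rewrite (simple_ratio_affine _ _ _ m H12 hQA1 hQA2 Hm).
rewrite (simple_ratio_affine _ _ _ n (not_eq_sym H02) hRA2 hRA0 Hn).
assert (L : 1 - l <> 0) by exact (affine_param_neq_r _ _ _ _ Hl hPA1).
assert (M : 1 - m <> 0) by exact (affine_param_neq_r _ _ _ _ Hm hQA2).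
assert (N : 1 - n <> 0) by exact (affine_param_neq_r _ _ _ _ Hn hRA0).
assert (HC : l * m * n = (1 - l) * (1 - m) * (1 - n)).
{ unfold affine_param in *.
  apply (ceva (straighten A0) (straighten A1) (straighten A2) (straighten T)
           l m n r s t); auto; congruence. }
transitivity (l * m * n / ((1 - l) * (1 - m) * (1 - n))).
- field; auto.
- rewrite HC; field; auto.
Qed.
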